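(* Let $U$ be an open neighborhood of the origin in $\mathbb{R}^n$ and let $X$ be a smooth vector field on $U$. (1) As $t\to0$, we have $$\delta_t^*X\simeq\sum_{\ell\ge-r}t^\ell X^{[\ell]}\qquad\text{in }\mathcal{X}(U),$$ where $X^{[\ell]}$ is a homogeneous polynomial vector field of degree $\ell$. (2) $X$ has weight $w$ ($w\in\mathbb{Z}$) if and only if, as $t\to0$, we have $$\delta_t^*X=t^wX^{[w]}+\operatorname{O}\left(t^{w+1}\right)\qquad\text{in }\mathcal{X}(U),$$ with $X^{[w]}\neq0$.
   Context: $(w_1,\ldots,w_n)$ is the weight sequence of an $n$-dimensional Carnot manifold of step $r$; all that matters here is that it is a non-decreasing sequence of integers in $\{1,\ldots,r\}$. Set $\delta_t(x)=t\cdot x=(t^{w_1}x_1,\ldots,t^{w_n}x_n)$ and $\langle\alpha\rangle=w_1\alpha_1+\cdots+w_n\alpha_n$ for $\alpha\in\mathbb{N}_0^n$. For $t\ne0$, $\delta_t^*X$ is the pullback vector field on $\delta_t^{-1}(U)$: $(\delta_t^*X)u(x)=X(u\circ\delta_t^{-1})(t\cdot x)$. A vector field $Y$ on $\mathbb{R}^n$ is homogeneous of degree $\ell\in\mathbb{Z}$ if $\delta_t^*Y=t^\ell Y$ for all $t\in\mathbb{R}\setminus\{0\}$. A smooth function $f$ near $0$ has weight $\ge m$ if $\partial^\alpha f(0)=0$ for all $\alpha$ with $\langle\alpha\rangle<m$; it has weight $m$ if moreover $\partial^\alpha f(0)\ne0$ for some $\alpha$ with $\langle\alpha\rangle=m$.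 A vector field $X=\sum_ja_j(x)\partial_{x_j}$ on $U$ has weight $w\in\mathbb{Z}$ if each $a_j$ has weight $\ge w+w_j$ and at least one $a_j$ has weight exactly $w+w_j$. $\mathcal{X}(U)$ is the space of smooth vector fields on $U$ with the topology of uniform convergence on compact sets of all derivatives of the coefficients. The asymptotic expansion in (1) means that for every integer $N$ and compact $K\subset U$, all derivatives of the coefficients of $\delta_t^*X-\sum_{-r\le\ell<N}t^\ell X^{[\ell]}$ are $\operatorname{O}(t^N)$ uniformly on $K$ as $t\to0$; $\operatorname{O}(t^{w+1})$ in (2) is understood similarly. *)

(* Defs.v *)
From mathcomp Require Import all_boot all_order all_algebra.
From mathcomp Require Import boolp classical_sets functions reals topology.
From mathcomp Require Import normedtype derive.
From mathcomp Require mpoly.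

Set Implicit Arguments.
Unset Strict Implicit.
Unset Printing Implicit Defensive.

Import Order.TTheory GRing.Theory Num.Theory numFieldNormedType.Exports.
Local Open Scope ring_scope.
Local Open Scope classical_set_scope.

Section PartialDerivatives.
Variables (R : realType) (n : nat).
Implicit Types (f : 'rV[R]_n -> R) (U : set 'rV[R]_n).

Definition pderiv (i : 'I_n) f : 'rV[R]_n -> R := 'D_(delta_mx 0 i) f.

Definition pderivs (s : seq 'I_n) f : 'rV[R]_n -> R := foldr pderiv f s.

(* The mixed derivative d_1^(a_1) ... d_n^(a_n) f. *)
Definition mderiv (a : {ffun 'I_n -> nat}) f : 'rV[R]_n -> R :=
  pderivs (flatten [seq nseq (a i) i | i <- enum 'I_n]) f.

(* All iterated partial derivatives, in every order, exist and are continuous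
   on U.  For U open this does not depend on the values of f outside U. *)
Definition smooth_on U f : Prop :=
  forall (s : seq 'I_n) (x : 'rV[R]_n), U x ->
    {for x, continuous (pderivs s f)} /\
    forall i, derivable (pderivs s f) x (delta_mx 0 i).

End PartialDerivatives.

(* X stands for sum_j (X x 0 j) d/dx_j.  A vector field on an open set U is a
   total function of which only the values on U are meaningful. *)
Definition vfield (R : realType) (n : nat) := 'rV[R]_n -> 'rV[R]_n.

Section VectorFields.
Variables (R : realType) (n : nat).
Implicit Types (X Y : vfield R n) (U : set 'rV[R]_n).

Definition coef X (j : 'I_n) : 'rV[R]_n -> R := fun x => X x 0 j.

Definition smooth_vfield U X : Prop := forall j, smooth_on U (coef X j).

Definition vapply X (u : 'rV[R]_n -> R) : 'rV[R]_n -> R :=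
  fun x => \sum_j coef X j x * pderiv j u x.

Definition polynomial_vfield X : Prop :=
  forall j, exists p : mpoly.mpoly n R,
    forall x, coef X j x = mpoly.meval (fun i => x 0 i) p.

(* F t = O(t^N) in X(U) as t -> 0, t <> 0. The bounds are only required for t
   small depending on K, so F t only has to be defined near K for such t. *)
Definition vfield_bigO U (F : R -> vfield R n) (N : int) : Prop :=
  forall K : set 'rV[R]_n, compact K -> K `<=` U ->
  forall (a : {ffun 'I_n -> nat}) (j : 'I_n),
  exists C : R, \forall t \near 0^', forall x, K x ->
    `|mderiv a (coef (F t) j) x| <= C * `|t| ^ N.

End VectorFields.

Section Weights.
Variables (R : realType) (n : nat) (wt : 'I_n -> nat).
Implicit Types (f u : 'rV[R]_n -> R) (X Y : vfield R n) (U : set 'rV[R]_n).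

Definition dilation (t : R) (x : 'rV[R]_n) : 'rV[R]_n :=
  \row_j (t ^+ wt j * x 0 j).

Definition wdeg (a : {ffun 'I_n -> nat}) : nat := (\sum_i wt i * a i)%N.

(* The coefficients of the pullback are obtained from
   (delta_t^* X) u (x) = X (u o delta_t^-1) (t.x) by taking for u the coordinate
   functions; vapply_pullback gives the formula for general u. *)
Definition pullback (t : R) X : vfield R n := fun x =>
  \row_j vapply X ((fun y : 'rV[R]_n => y 0 j) \o dilation t^-1) (dilation t x).

Definition homogeneous (l : int) Y : Prop :=
  forall t : R, t != 0 -> forall x, pullback t Y x = t ^ l *: Y x.

Definition fun_weight_ge (m : int) f : Prop :=
  forall a, (wdeg a)%:Z < m -> mderiv a f 0 = 0.

Definition fun_weight (m : int) f : Prop :=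
  fun_weight_ge m f /\ exists a, (wdeg a)%:Z = m /\ mderiv a f 0 <> 0.

Definition vfield_weight (w : int) X : Prop :=
  (forall j, fun_weight_ge (w + (wt j)%:Z) (coef X j)) /\
  (exists j, fun_weight (w + (wt j)%:Z) (coef X j)).

(* The sum over -r <= l < N of t^l Xh l, indexed by k = l + r. *)
Definition partial_expansion (r : nat) (Xh : int -> vfield R n) (N : int)
    (t : R) : vfield R n := fun x =>
  \sum_(0 <= k < absz (Num.max 0 (N + r%:Z)))
    t ^ (k%:Z - r%:Z) *: Xh (k%:Z - r%:Z) x.

(* The terms of index l < -r, absent from the expansion, are 0 by convention. *)
Definition homogeneous_expansion (r : nat) U X (Xh : int -> vfield R n) : Prop :=
  [/\ forall l : int, - r%:Z <= l ->
        polynomial_vfield (Xh l) /\ homogeneous l (Xh l),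
      forall l : int, l < - r%:Z -> Xh l = cst 0
    & forall N : int,
        vfield_bigO U
          (fun t x => pullback t X x - partial_expansion r Xh N t x) N].

Lemma dilationK (t : R) : t != 0 -> cancel (dilation t) (dilation t^-1).
Proof.
move=> t0 x; apply/rowP => j; rewrite !mxE mulrA -exprMn mulVf //.
by rewrite expr1n mul1r.
Qed.

Lemma pderiv_dilation (t : R) i u x : t != 0 ->
  derivable u x (delta_mx 0 i) ->
  pderiv i (u \o dilation t^-1) (dilation t x) = t^-1 ^+ wt i * pderiv i u x.
Proof.
move=> t0 du; rewrite /pderiv /derive /=; set c := t^-1 ^+ wt i.
have c0 : c != 0 by rewrite expf_neq0 // invr_neq0.
apply: cvg_lim => //; rewrite dilationK //.
have step h : dilation t^-1 (h *: delta_mx 0 i + dilation t x)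
            = (c * h) *: delta_mx 0 i + x.
  apply/rowP => j; rewrite !mxE /= mulrDr [X in _ + X]mulrA -exprMn mulVf // expr1n mul1r.
  congr (_ + _); rewrite mulrCA /c; have [->|] := eqVneq j i.
    by rewrite mulrCA mulrA.
  by rewrite !mulr0.
rewrite (_ : (fun h => _) = (fun h : R => c *: ((fun k : R =>
    k^-1 *: (u (k *: delta_mx 0 i + x) - u x)) (c * h)))); last first.
  apply/funext => h; rewrite step scalerA; congr (_ *: _).
  by rewrite invfM mulrA divff // mul1r.
apply: cvgMl_tmp.
have cvg_scale : (fun h : R => c * h) @ 0^' --> 0^'.
  move=> A [e /= e0 eA]; exists (e / `|c|).
    by rewrite /= divr_gt0 // normr_gt0.
  move=> h /=; rewrite sub0r normrN => hlt h0; apply: eA => /=.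
    by rewrite sub0r normrN normrM mulrC -ltr_pdivlMr // normr_gt0.
  by rewrite mulf_neq0.
exact: (cvg_comp _ _ cvg_scale du).
Qed.

Lemma coef_pullback (t : R) X j x : t != 0 ->
  coef (pullback t X) j x = t^-1 ^+ wt j * coef X j (dilation t x).
Proof.
move=> t0; rewrite /coef mxE /vapply.
have pc i : derivable (fun y : 'rV[R]_n => y 0 j) x (delta_mx 0 i) /\
            pderiv i (fun y : 'rV[R]_n => y 0 j) x = (i == j)%:R.
  have H : (fun h : R => h^-1 *: ((h *: delta_mx 0 i + x : 'rV[R]_n) 0 j - x 0 j))
           @ 0^' --> ((i == j)%:R : R).
    apply: cvg_near_cst; exists 1 => //= h _ h0.
    rewrite !mxE /= addrK eq_sym [_ *: _](mulrA h^-1) mulVf // mul1r.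
    by rewrite eq_sym.
  by split; [apply/cvg_ex; exists (i == j)%:R | exact: cvg_lim].
rewrite (bigD1 j) //= big1 => [|i ij]; last first.
  have [di ei] := pc i.
  by rewrite pderiv_dilation // ei (negbTE ij) !mulr0.
have [dj ej] := pc j.
by rewrite pderiv_dilation // ej eqxx mulr1 addr0 mulrC.
Qed.

Lemma vapply_pullback (t : R) X u x : t != 0 ->
  (forall j, derivable u x (delta_mx 0 j)) ->
  vapply (pullback t X) u x = vapply X (u \o dilation t^-1) (dilation t x).
Proof.
move=> t0 du; apply: eq_bigr => j _.
by rewrite coef_pullback // pderiv_dilation // mulrCA mulrA.
Qed.

End Weights.

(* Main.v *)
Require Import Defs.
From mathcomp Require Import all_boot all_order all_algebra.
From mathcomp Require Import boolp classical_sets functions reals topology.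
From mathcomp Require Import normedtype derive.
From mathcomp Require mpoly.
From mathcomp Require Import zify ring lra.

Import Order.TTheory GRing.Theory Num.Theory numFieldNormedType.Exports.
Local Open Scope ring_scope.
Local Open Scope classical_set_scope.

(* Let < a > be the weighted degree of a. Since the coefficients of delta_t^* X
   are t^(- w_j) a_j (delta_t x), everything rests on one equivalence for smooth
   vector fields Y: delta_t^* Y = O(t^N) if and only if the Taylor coefficients
   d^a a_j(0) with < a > - w_j < N all vanish. One direction is evaluation at
   x = 0. The other follows from the bound |h(delta_t x)| <= C |t|^m for h of
   weight >= m, by induction on m: moving from 0 to delta_t x one coordinate at
   a time, the mean value theorem brings out |t|^(w_i) times a value of d_i h,
   which has weight >= m - w_i. As d^a gains a factor t^< a >,
   the same bound covers all derivatives.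

   Part (1) is this equivalence for X minus the vector fields X^[l] whose
   coefficients collect the Taylor monomials with < a > - w_j = l.  For part (2),
   a homogeneous field of degree l only has Taylor coefficients with
   < a > - w_j = l, and vanishes if they all do, so any expansion has the same
   Taylor coefficients as X. *)

(** * Calculus of iterated partial derivatives on an open set *)

Section SmoothFunctions.
Set Implicit Arguments.
Unset Strict Implicit.
Variables (R : realType) (n : nat).
Implicit Types (f g : 'rV[R]_n -> R) (U : set 'rV[R]_n).

Lemma pderivs_cat (s1 s2 : seq 'I_n) f :
  pderivs (s1 ++ s2) f = pderivs s1 (pderivs s2 f).
Proof. exact: foldr_cat. Qed.

Lemma smooth_on_pderivs U f (s : seq 'I_n) :
  smooth_on U f -> smooth_on U (pderivs s f).
Proof. by move=> sf s1 x Ux; rewrite -pderivs_cat; exact: sf. Qed.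

Lemma smooth_on_is_derive U f (s : seq 'I_n) i x : smooth_on U f -> U x ->
  is_derive x (delta_mx 0 i) (pderivs s f) (pderivs (i :: s) f x).
Proof. by move=> sf Ux; apply: derivableP; exact: (sf s x Ux).2. Qed.

(* A family closed under partial differentiation on an open set consists of
   the iterated partial derivatives of its first member. *)
Lemma smooth_on_family U (F : seq 'I_n -> 'rV[R]_n -> R) : open U ->
  (forall s x, U x -> {for x, continuous (F s)}) ->
  (forall s i x, U x -> is_derive x (delta_mx 0 i) (F s) (F (i :: s) x)) ->
  smooth_on U (F [::]) /\
  (forall s x, U x -> pderivs s (F [::]) x = F s x).
Proof.
move=> oU cF dF.
have E s x : U x -> pderivs s (F [::]) x = F s x.
  elim: s x => [//|i s IH] x Ux /=.
  have <- := @derive_val _ _ _ _ _ _ _ (dF s i x Ux).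
  by apply: near_eq_derive; near=> y; apply: IH; near: y; exact: open_nbhs_nbhs.
split=> // s x Ux.
have N : \near x, F s x = pderivs s (F [::]) x.
  by near=> y; apply/esym/E; near: y; exact: open_nbhs_nbhs.
split=> [|i].
- have := cF s x Ux; rewrite /prop_for /continuous_at -(E s x Ux).
  exact: cvg_trans (near_eq_cvg N).
- by apply: near_eq_derivable N _; have := dF s i x Ux => -[].
Unshelve. all: by end_near. Qed.

(** One combined form serves sums ([c = 1]), differences ([c = -1]) and scalar multiples
    ([f = 0]). *)
Lemma smooth_on_addZ U f g (c : R) : open U -> smooth_on U f -> smooth_on U g ->
  smooth_on U (fun x => f x + c * g x) /\
  forall s x, U x ->
    pderivs s (fun x => f x + c * g x) x = pderivs s f x + c * pderivs s g x.
Proof.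
move=> oU sf sg.
apply: (@smooth_on_family U (fun s x => pderivs s f x + c * pderivs s g x)) => //.
- move=> s x Ux; apply: continuousD; first exact: (sf s x Ux).1.
  apply: continuousM; first exact: cst_continuous.
  exact (sg s x Ux).1.
- move=> s i x Ux; apply: is_deriveD; first exact (smooth_on_is_derive _ _ sf Ux).
  exact: is_deriveZ (smooth_on_is_derive _ _ sg Ux).
Qed.

Lemma smooth_on_cst0 U : open U ->
  smooth_on U (fun=> 0) /\ forall s x, U x -> pderivs s (fun=> 0) x = 0.
Proof.
move=> oU; apply: (@smooth_on_family U (fun _ _ => 0)) => // s x Ux.
exact: cst_continuous.
Qed.

Lemma smooth_on_sum U (I : Type) (r : seq I) (f : I -> 'rV[R]_n -> R) :
  open U -> (forall k, smooth_on U (f k)) ->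
  smooth_on U (fun x => \sum_(k <- r) f k x) /\
  forall s x, U x -> pderivs s (fun x => \sum_(k <- r) f k x) x
                     = \sum_(k <- r) pderivs s (f k) x.
Proof.
move=> oU sf; elim: r => [|k r [IHs IHd]].
  under eq_fun do rewrite big_nil.
  have [s0 d0] := smooth_on_cst0 oU.
  by split=> // s x Ux; rewrite big_nil d0.
have -> : (fun x => \sum_(j <- k :: r) f j x) =
          (fun x => f k x + 1 * \sum_(j <- r) f j x).
  by apply/funext => x; rewrite big_cons mul1r.
have [sD dD] := smooth_on_addZ 1 oU (sf k) IHs.
by split=> // s x Ux; rewrite dD // IHd // mul1r big_cons.
Qed.

End SmoothFunctions.

(** * Mean value theorem along lines and symmetry of mixed partial derivatives *)

Section MixedPartials.
Set Implicit Arguments.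
Unset Strict Implicit.
Variables (R : realType) (n : nat).
Implicit Types (f g : 'rV[R]_n -> R) (U : set 'rV[R]_n).

Lemma is_derive_shift f (a x v : 'rV[R]_n) (d : R) :
  is_derive (a + x) v f d -> is_derive x v (fun y => f (a + y)) d.
Proof.
have E : (fun h : R => h^-1 *: (((fun y => f (a + y)) \o shift x) (h *: v)
                                - f (a + x))) =
         (fun h : R => h^-1 *: ((f \o shift (a + x)) (h *: v) - f (a + x))).
  by apply/funext => h /=; rewrite addrCA.
by case=> df <-; apply: DeriveDef; rewrite /derivable /derive E.
Qed.

Lemma is_derive_line f (x v : 'rV[R]_n) (s d : R) :
  is_derive (s *: v + x) v f d -> is_derive s 1 (fun t => f (t *: v + x)) d.
Proof.
have E : (fun h : R => h^-1 *: (((fun t : R => f (t *: v + x)) \o shift s)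
                                  (h *: 1) - f (s *: v + x))) =
  (fun h : R => h^-1 *: ((f \o shift (s *: v + x)) (h *: v) - f (s *: v + x))).
  by apply/funext => h /=; rewrite scalerDl addrA [h *: 1]mulr1.
by case=> df <-; apply: DeriveDef; rewrite /derivable /derive E.
Qed.

(** Increments of either sign occur, so the one-variable theorem is applied on [[0, h]] or on
    [[h, 0]]. *)
Lemma line_MVT f df (x v : 'rV[R]_n) (h : R) :
  (forall c : R, `|c| <= `|h| -> is_derive (c *: v + x) v f (df (c *: v + x))) ->
  exists2 c : R, `|c| <= `|h| & f (h *: v + x) - f x = df (c *: v + x) * h.
Proof.
move=> Df; pose g (s : R) := f (s *: v + x).
have Dg (s : R) : `|s| <= `|h| -> is_derive s 1 g (df (s *: v + x)).
  by move=> /Df; exact: is_derive_line.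
have cont a b : (forall s, s \in `[a, b]%R -> `|s| <= `|h|) ->
    {within `[a, b], continuous g}.
  by move=> ab; apply: derivable_within_continuous => s /ab /Dg [].
have -> : f x = g 0 by rewrite /g scale0r add0r.
have [h0|h0] := leP 0 h.
- have I s : s \in `[0, h]%R -> `|s| <= `|h|.
    by rewrite in_itv /= => /andP[s0 sh]; rewrite !ger0_norm.
  have [c /I ch E] := MVT_segment h0
    (fun s sI => Dg s (I s (subset_itv_oo_cc sI))) (cont _ _ I).
  by exists c => //; rewrite -/(g h) E subr0.
- have I s : s \in `[h, 0]%R -> `|s| <= `|h|.
    rewrite in_itv /= => /andP[s0 sh]; rewrite !ler0_norm ?lerN2 //.
    exact: ltW.
  have [c /I ch E] := MVT_segment (ltW h0)
    (fun s sI => Dg s (I s (subset_itv_oo_cc sI))) (cont _ _ I).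
  by exists c => //; rewrite -/(g h) -[LHS]opprB E sub0r mulrN opprK.
Qed.

Lemma row_norm_leP (x : 'rV[R]_n) (B : R) : 0 <= B ->
  `|x| <= B <-> forall i, `|x 0 i| <= B.
Proof.
move=> B0; have -> : `|x| = mx_norm x by [].
rewrite mx_normrE; split=> [/bigmax_leP [_ H] i|H].
  exact: (H (0, i)).
by apply/bigmax_leP; split => // -[k i] _; rewrite (ord1 k); exact: H.
Qed.

Lemma norm_coord_le (x : 'rV[R]_n) i : `|x 0 i| <= `|x|.
Proof. by move: i; apply/row_norm_leP. Qed.

Lemma norm_delta_mx_le1 i : `|delta_mx 0 i : 'rV[R]_n| <= 1.
Proof.
apply/row_norm_leP => // j.
by rewrite mxE; case: andb; rewrite ?normr0 ?normr1.
Qed.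

Lemma near_norm_ball (x : 'rV[R]_n) (P : set 'rV[R]_n) :
  (\forall y \near x, P y) ->
  exists2 d : R, 0 < d & forall y, `|y - x| < d -> P y.
Proof.
move=> /nbhs_ballP [d d0 dP]; exists d => // y yx; apply: dP.
by rewrite mx_norm_ball /ball_ /= distrC.
Qed.

(** The mean value theorem is used twice: in direction [i] for the increment of [f] along [j], then
    in direction [j] for the resulting partial derivative. *)
Lemma second_difference U f i j (x : 'rV[R]_n) (h : R) : smooth_on U f ->
  (forall y, `|y - x| <= `|h| + `|h| -> U y) ->
  exists2 y, `|y - x| <= `|h| + `|h| &
  f (h *: delta_mx 0 j + (h *: delta_mx 0 i + x)) - f (h *: delta_mx 0 i + x)
  - (f (h *: delta_mx 0 j + x) - f x) = pderivs [:: j; i] f y * h * h.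
Proof.
move=> sf hU; set ei := delta_mx 0 i; set ej := delta_mx 0 j.
have near (a b : R) : `|a| <= `|h| -> `|b| <= `|h| ->
    `|a *: ej + (b *: ei + x) - x| <= `|h| + `|h|.
  move=> ah bh; rewrite addrA addrK; apply: le_trans (ler_normD _ _) _.
  by rewrite !normrZ lerD // -[leRHS]mulr1 ler_pM // norm_delta_mx_le1.
have near1 (b : R) : `|b| <= `|h| -> `|b *: ei + x - x| <= `|h| + `|h|.
  by move=> bh; have := near 0 b; rewrite scale0r add0r; apply; rewrite ?normr0.
have [|b bh E] := @line_MVT (fun y => f (h *: ej + y) - f y)
    (fun y => pderivs [:: i] f (h *: ej + y) - pderivs [:: i] f y) x ei h.
  move=> c ch; apply: is_deriveB.
  - apply: is_derive_shift; apply: (smooth_on_is_derive [::] i sf).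
    by apply: hU; exact: near.
  - by apply: (smooth_on_is_derive [::] i sf); apply: hU; exact: near1.
have [|a ah E'] := @line_MVT (pderivs [:: i] f) (pderivs [:: j; i] f)
    (b *: ei + x) ej h.
  move=> c ch; apply: (smooth_on_is_derive [:: i] j sf).
  by apply: hU; exact: near.
exists (a *: ej + (b *: ei + x)); first exact: near.
by rewrite E E'.
Qed.

(** The second difference is symmetric in [i] and [j], so arbitrarily close to [x] the two mixed
    derivatives share a value; by continuity they cannot differ at [x]. *)
Lemma pderivsC U f i j (x : 'rV[R]_n) : open U -> smooth_on U f -> U x ->
  pderivs [:: i; j] f x = pderivs [:: j; i] f x.
Proof.
move=> oU sf Ux; apply/eqP/negPn/negP => ne.
set A := pderivs [:: i; j] f; set B := pderivs [:: j; i] f.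
have e0 : 0 < `|A x - B x| / 2 by rewrite divr_gt0 // normr_gt0 subr_eq0.
have cA : \forall y \near x, `|A x - A y| < `|A x - B x| / 2.
  by have /cvgrPdist_lt := (sf [:: i; j] x Ux).1; apply.
have cB : \forall y \near x, `|B x - B y| < `|A x - B x| / 2.
  by have /cvgrPdist_lt := (sf [:: j; i] x Ux).1; apply.
have nU : \forall y \near x, U y by exact: open_nbhs_nbhs.
have [d d0 H] := near_norm_ball (filterI (filterI cA cB) nU).
(* The increment is [d / 4] since second differences reach points at distance up to twice the
   increment, which must stay below [d]. *)
have hE : `|d / 4| + `|d / 4| < d by clear -d0; rewrite ger0_norm; lra.
have hU y : `|y - x| <= `|d / 4| + `|d / 4| -> U y.
  move=> yx; have [] // := H y; exact: le_lt_trans hE.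
have inner y : `|y - x| <= `|d / 4| + `|d / 4| ->
  `|A x - A y| < `|A x - B x| / 2 /\ `|B x - B y| < `|A x - B x| / 2.
  move=> yx; have [] // := H y; exact: le_lt_trans hE.
have [y /inner[_ yB] E1] := second_difference i j sf hU.
have [z /inner[zA _] E2] := second_difference j i sf hU.
(* Both sides, times the squared increment, are the same second difference. *)
have AB : A z = B y.
  have h0 : d / 4 != 0 by rewrite gt_eqF // divr_gt0.
  suff : A z * (d / 4) * (d / 4) = B y * (d / 4) * (d / 4).
    by move=> /(mulIf h0)/(mulIf h0).
  rewrite -[LHS]E2 -[RHS]E1 (addrCA (_ *: delta_mx 0 i)).
  by clear; ring.
move: yB; rewrite -AB; move: (A x) (B x) (A z) zA => a b c; clear => ac bc.
by have := ler_distD c a b; rewrite (distrC c b); lra.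
Qed.

Lemma eq_on_pderiv U f g i : open U -> (forall x, U x -> f x = g x) ->
  forall x, U x -> pderiv i f x = pderiv i g x.
Proof.
move=> oU fg x Ux; apply: near_eq_derive; near=> y; apply: fg.
by near: y; exact: open_nbhs_nbhs.
Unshelve. all: by end_near. Qed.

(** By induction on [s1]: its head occurs in [s2] and is brought to the front there by adjacent
    swaps, each an instance of [pderivsC]. *)
Lemma pderivs_perm U f (s1 s2 : seq 'I_n) : open U -> smooth_on U f ->
  perm_eq s1 s2 -> forall x, U x -> pderivs s1 f x = pderivs s2 f x.
Proof.
move=> oU sf; elim: s1 s2 => [s2|i s1 IH s2 p].
  by rewrite perm_sym => /perm_nilP ->.
have : i \in s2 by rewrite -(perm_mem p) mem_head.
move=> /path.splitPr s2E; case: s2E p => a b.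
rewrite perm_sym perm_catC /= perm_cons perm_catC perm_sym => p.
have move_to_front x : U x ->
    pderivs (a ++ i :: b) f x = pderivs (i :: a ++ b) f x.
  elim: a x {p} => [//|j a IHa] x Ux.
  have -> : pderivs ((j :: a) ++ i :: b) f x =
            pderivs [:: j; i] (pderivs (a ++ b) f) x.
    exact: eq_on_pderiv oU IHa _ Ux.
  by rewrite (pderivsC _ _ oU (smooth_on_pderivs _ sf)).
move=> x Ux; rewrite move_to_front //.
exact: eq_on_pderiv oU (IH _ p) _ Ux.
Qed.

End MixedPartials.

(** * The bound of order m along dilations for functions of weight at least m *)

Section WeightedEstimate.
Set Implicit Arguments.
Unset Strict Implicit.
Variables (R : realType) (n : nat) (wt : 'I_n -> nat).
Implicit Types (f h : 'rV[R]_n -> R) (U : set 'rV[R]_n).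
Hypothesis wt_gt0 : forall i, (0 < wt i)%N.

(** The weighted degree for derivatives indexed by sequences, the form suited to differentiating one
    index at a time; [fun_weight_geP] returns to multi-indices. *)
Definition seq_weight (s : seq 'I_n) : nat := (\sum_(i <- s) wt i)%N.

Lemma norm_dilation_le (t : R) (x : 'rV[R]_n) :
  `|t| <= 1 -> `|dilation wt t x| <= `|t| * `|x|.
Proof.
move=> t1; apply/row_norm_leP => [|i]; first by rewrite mulr_ge0.
rewrite mxE normrM normrX ler_pM ?exprn_ge0 //.
  by rewrite -[leRHS]expr1 ler_wiXn2l.
exact: norm_coord_le.
Qed.

Lemma near_dilation (P : set 'rV[R]_n) (B : R) : 0 <= B ->
  (\forall y \near (0 : 'rV[R]_n), P y) ->
  \forall t \near (0 : R)^', forall x, `|x| <= B -> P (dilation wt t x).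
Proof.
move=> B0 /near_norm_ball [d d0 H].
near=> t => x xB; apply: H; rewrite subr0.
have t1 : `|t| <= 1 by near: t; exact: dnbhs0_le.
have td : `|t| < d / (B + 1).
  by near: t; apply: dnbhs0_lt; rewrite divr_gt0 // ltr_wpDl.
apply: le_lt_trans (norm_dilation_le _ t1) _.
rewrite ltr_pdivlMr ?ltr_wpDl // in td.
by apply: le_lt_trans td; rewrite ler_wpM2l // (le_trans xB) // lerDl.
Unshelve. all: by end_near. Qed.

(** The induction on [m] is strong, since a derivative along [i] lowers the order by [wt i] at once.
    The constant and the range of [t] are uniform over the ball of radius [B]. *)
Lemma weighted_bound U h m (B : R) : open U -> U 0 -> smooth_on U h ->
  (forall s, (seq_weight s < m)%N -> pderivs s h 0 = 0) -> 0 <= B ->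
  exists2 C : R, 0 <= C & \forall t \near (0 : R)^',
    forall x, `|x| <= B -> `|h (dilation wt t x)| <= C * `|t| ^+ m.
Proof.
move=> oU U0 + + B0; have [k] := ubnP m; elim: k m h => // k IH [|m] h mk sh h0.
  (* For order 0 the bound is local boundedness of [h], from continuity at 0. *)
  exists (`|h 0| + 1); first by rewrite addr_ge0.
  have : \forall y \near (0 : 'rV[R]_n), `|h y| <= `|h 0| + 1.
    have /cvgrPdist_le /(_ _ ltr01) := (sh [::] 0 U0).1.
    apply: filterS => y hy; rewrite addrC -lerBlDr.
    by apply: le_trans hy; rewrite distrC lerB_dist.
  move=> /(near_dilation B0); apply: filterS => t H x /H.
  by rewrite expr0 mulr1.
(* The subtraction is truncated: if [wt i] exceeds [m.+1], only boundedness of the derivative is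
   claimed. *)
have step i : exists C : R, 0 <= C /\ \forall t \near (0 : R)^',
    forall x, `|x| <= B ->
      `|pderivs [:: i] h (dilation wt t x)| <= C * `|t| ^+ (m.+1 - wt i).
  have [||s sm|C C0 HC] := IH (m.+1 - wt i)%N (pderivs [:: i] h).
  - by have := wt_gt0 i; lia.
  - exact: smooth_on_pderivs.
  - rewrite -pderivs_cat; apply: h0; move: sm.
    by rewrite /seq_weight big_cat big_seq1 /=; lia.
  - by exists C.
have [C HC] := choice step.
exists (\sum_i C i * B).
  by apply: sumr_ge0 => i _; rewrite mulr_ge0 //; exact: (HC i).1.
have nU : \forall y \near (0 : 'rV[R]_n), U y by exact: open_nbhs_nbhs.
have nC : \forall t \near (0 : R)^', forall i x, `|x| <= B ->
    `|pderivs [:: i] h (dilation wt t x)| <= C i * `|t| ^+ (m.+1 - wt i).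
  by apply: filter_forall => i; exact: (HC i).2.
near=> t => x xB.
have t0 : t != 0 by near: t; exact: nbhs_dnbhs_neq.
have t1 : `|t| <= 1 by near: t; exact: dnbhs0_le.
have Ut y : `|y| <= B -> U (dilation wt t y).
  by move: y; near: t; exact: near_dilation.
have Dt i y : `|y| <= B ->
    `|pderivs [:: i] h (dilation wt t y)| <= C i * `|t| ^+ (m.+1 - wt i).
  by move: i y; near: t.
(* A staircase from 0 to the dilated point: [y k] has its first [k] coordinates filled in, so
   consecutive points differ in one coordinate. *)
pose y (k : nat) : 'rV[R]_n :=
  \row_j (if (j < k)%N then dilation wt t x 0 j else 0).
have -> : h (dilation wt t x) = \sum_(i < n) (h (y i.+1) - h (y i)).
  rewrite -(big_mkord xpredT (fun i => h (y i.+1) - h (y i))) telescope_sumr //.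
  have -> : y 0 = 0 by apply/rowP => j; rewrite !mxE.
  have -> : h 0 = 0 by apply: (h0 [::]); rewrite /seq_weight big_nil.
  by rewrite subr0; congr h; apply/rowP => j; rewrite !mxE ltn_ord.
apply: le_trans (ler_norm_sum _ _ _) _.
rewrite mulr_suml; apply: ler_sum => i _.
set b := dilation wt t x 0 i.
have bE : b = t ^+ wt i * x 0 i by rewrite /b mxE.
have xi : `|x 0 i| <= B by apply: le_trans xB; exact: norm_coord_le.
have -> : y i.+1 = b *: delta_mx 0 i + y i.
  apply/rowP => j; rewrite !mxE eqxx /= ltnS leq_eqVlt.
  have [->|ji] := eqVneq j i.
    by rewrite eqxx ltnn /= mulr1 addr0 bE.
  by rewrite (inj_eq val_inj) (negbTE ji) /= mulr0 add0r.
(* Each intermediate point of the staircase is itself the dilation by [t] of a point of norm at most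
   [B], so the bounds on the first derivatives apply there. *)
have onbox c : `|c| <= `|b| -> exists2 z, `|z| <= B &
    c *: delta_mx 0 i + y i = dilation wt t z.
  move=> cb; exists (\row_j (if (j < i)%N then x 0 j else
                        if j == i then c / t ^+ wt i else 0)).
    apply/row_norm_leP => // j; rewrite mxE.
    case: ifP => _; first by apply: le_trans xB; exact: norm_coord_le.
    case: ifP => _; last by rewrite normr0.
    rewrite normrM normfV ler_pdivrMr ?normr_gt0 ?expf_neq0 //.
    by apply: le_trans cb _; rewrite bE normrM mulrC ler_wpM2r.
  apply/rowP => j; rewrite !mxE eqxx /=.
  have [->|ji] := eqVneq j i.
    by rewrite ltnn /= mulr1 addr0 mulrCA mulfV ?mulr1 ?expf_neq0.
  by rewrite mulr0 add0r; case: ifP => // _; rewrite mulr0.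
have [|c /onbox [z zB ->] ->] :=
    @line_MVT _ _ h (pderivs [:: i] h) (y i) (delta_mx 0 i) b.
  move=> c /onbox [z zB ->].
  by apply: (smooth_on_is_derive [::] i sh); exact: Ut.
rewrite normrM; apply: (@le_trans _ _
  (C i * `|t| ^+ (m.+1 - wt i) * (`|t| ^+ wt i * B))).
  apply: ler_pM => //; first exact: Dt.
  by rewrite bE normrM normrX ler_wpM2l // exprn_ge0.
have -> : C i * `|t| ^+ (m.+1 - wt i) * (`|t| ^+ wt i * B) =
          C i * B * `|t| ^+ (m.+1 - wt i + wt i) by rewrite exprD; ring.
apply: ler_wpM2l; first by rewrite mulr_ge0 //; exact: (HC i).1.
(* Truncation can make the exponent larger than [m.+1], which is harmless as [|t| <= 1]. *)
by apply: ler_wiXn2l => //; lia.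
Unshelve. all: by end_near. Qed.

End WeightedEstimate.

(** * Derivatives of dilated functions, weights in terms of sequences, and comparison of powers of
    t *)

Section DilationDerivatives.
Set Implicit Arguments.
Unset Strict Implicit.
Variables (R : realType) (n : nat) (wt : 'I_n -> nat).
Implicit Types (f g : 'rV[R]_n -> R) (U : set 'rV[R]_n) (a : {ffun 'I_n -> nat}).
Hypothesis wt_gt0 : forall i, (0 < wt i)%N.

(** With [c = t ^+ wt i], the difference quotient at [x] with step [h] is [c] times the one at the
    dilated point with step [c * h]. *)
Lemma is_derive_dilation (t : R) g i x d : t != 0 ->
  is_derive (dilation wt t x) (delta_mx 0 i) g d ->
  is_derive x (delta_mx 0 i) (fun y => g (dilation wt t y)) (t ^+ wt i * d).
Proof.
move=> t0 [dg <-]; set c := t ^+ wt i.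
have c0 : c != 0 by rewrite expf_neq0.
have E : (fun h : R => h^-1 *: (((fun y => g (dilation wt t y)) \o shift x)
            (h *: delta_mx 0 i) - g (dilation wt t x))) =
         (fun h : R => c *: ((fun k : R => k^-1 *: ((g \o shift (dilation wt t x))
            (k *: delta_mx 0 i) - g (dilation wt t x))) (c * h))).
  apply/funext => h /=; rewrite scalerA invfM mulrA divff // mul1r.
  congr (_ *: (g _ - _)); apply/rowP => j; rewrite !mxE /= mulrDr mulrA.
  by have [->//|_] := eqVneq j i; rewrite !mulr0.
have cc : (fun h : R => c * h) @ 0^' --> 0^'.
  move=> A [e /= e0 eA]; exists (e / `|c|).
    by rewrite /= divr_gt0 ?normr_gt0.
  move=> h /=; rewrite sub0r normrN => he h0; apply: eA => /=.
    by rewrite sub0r normrN normrM mulrC -ltr_pdivlMr ?normr_gt0.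
  by rewrite mulf_neq0.
have L : (fun h : R => h^-1 *: (((fun y => g (dilation wt t y)) \o shift x)
    (h *: delta_mx 0 i) - g (dilation wt t x))) @ 0^'
    --> c * 'D_(delta_mx 0 i) g (dilation wt t x).
  by rewrite E; apply: cvgZl_tmp; exact: (cvg_comp _ _ cc dg).
by apply: DeriveDef; [apply/cvg_ex; eexists; exact: L|exact: cvg_lim].
Qed.

Lemma dilation_continuous (t : R) : `|t| <= 1 -> continuous (@dilation R n wt t).
Proof.
move=> t1 x P /near_norm_ball [d d0 dP]; apply/nbhs_ballP; exists d => // y.
rewrite mx_norm_ball /ball_ /= distrC => yx; apply: dP; apply: le_lt_trans yx.
have -> : dilation wt t y - dilation wt t x = dilation wt t (y - x).
  by apply/rowP => j; rewrite !mxE mulrBr.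
apply: le_trans (norm_dilation_le wt_gt0 _ t1) _.
by rewrite ler_piMl.
Qed.

(** Each index of [s] contributes one factor from [is_derive_dilation]. The constant [c] makes room
    for the power of [t^-1] in the coefficients of a pullback. *)
Lemma pderivs_dilation U g (c t : R) : open U -> smooth_on U g ->
  t != 0 -> `|t| <= 1 -> forall s x, U (dilation wt t x) ->
  pderivs s (fun y => c * g (dilation wt t y)) x =
  c * (t ^+ seq_weight wt s * pderivs s g (dilation wt t x)).
Proof.
move=> oU sg t0 t1.
pose F s x := c * (t ^+ seq_weight wt s * pderivs s g (dilation wt t x)).
have -> : (fun y => c * g (dilation wt t y)) = F [::].
  by apply/funext => y; rewrite /F /seq_weight big_nil expr0 mul1r.
have oV : open (dilation wt t @^-1` U).
  by apply: open_comp => // x _; exact: dilation_continuous.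
apply: (smooth_on_family oV _ _).2 => [s x Ux|s i x Ux].
- apply: continuousM; first exact: cst_continuous.
  apply: continuousM; first exact: cst_continuous.
  apply: continuous_comp; first exact: dilation_continuous.
  exact (sg s _ Ux).1.
- have H := is_derive_dilation t0 (smooth_on_is_derive s i sg Ux).
  apply: is_derive_eq (is_deriveZ c (is_deriveZ (t ^+ seq_weight wt s) H)) _.
  rewrite /F /seq_weight big_cons exprD [t ^+ wt i * t ^+ _]mulrC.
  by rewrite -[t ^+ _ * _ * _]mulrA.
Qed.

Definition monoseq a : seq 'I_n := flatten [seq nseq (a i) i | i <- enum 'I_n].

Lemma mderivE a f : mderiv a f = pderivs (monoseq a) f. Proof. by []. Qed.

Lemma seq_weight_monoseq a : seq_weight wt (monoseq a) = wdeg wt a.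
Proof.
rewrite /seq_weight /monoseq big_flatten big_map big_enum /=.
by apply: eq_bigr => i _; rewrite big_nseq iter_addn_0.
Qed.

Lemma count_monoseq a i : count_mem i (monoseq a) = a i.
Proof.
rewrite /monoseq count_flatten -map_comp sumnE big_map big_enum /=.
rewrite (bigD1 i) //= count_nseq /= eqxx mul1n big1 ?addn0 // => j ji.
by rewrite count_nseq /= (negbTE ji).
Qed.

Lemma perm_monoseq (s : seq 'I_n) :
  perm_eq s (monoseq [ffun i => count_mem i s]).
Proof.
by apply/allP => i _; rewrite /= count_monoseq ffunE.
Qed.

(** By symmetry of mixed partials, any sequence can be sorted into the one of a multi-index with the
    same weighted degree. *)
Lemma fun_weight_geP U f (m : int) : open U -> U 0 -> smooth_on U f ->
  fun_weight_ge wt m f <->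
  forall s, (seq_weight wt s)%:Z < m -> pderivs s f 0 = 0.
Proof.
move=> oU U0 sf; split=> H; last first.
  by move=> a am; apply: H; rewrite seq_weight_monoseq.
move=> s sm; rewrite (pderivs_perm oU sf (perm_monoseq s)) //; apply: H.
rewrite -seq_weight_monoseq /seq_weight.
by rewrite -(perm_big _ (perm_monoseq s)).
Qed.

(** After division by the power [p] of [|t|], the right side is at most [|C| * |t|], which falls
    below [|D|] unless [D] is 0. *)
Lemma eq0_of_bigO (D C : R) (p q : int) : p < q ->
  (\forall t \near (0 : R)^', `|D| * `|t| ^ p <= C * `|t| ^ q) -> D = 0.
Proof.
move=> pq H; apply/eqP/negPn/negP => D0.
have D0' : 0 < `|D| by rewrite normr_gt0.
have : \forall t \near (0 : R)^', False.
  near=> t.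
  have t0 : t != 0 by near: t; exact: nbhs_dnbhs_neq.
  have t1 : `|t| <= 1 by near: t; exact: dnbhs0_le.
  have tD : `|t| < `|D| / (`|C| + 1).
    by near: t; apply: dnbhs0_lt; rewrite divr_gt0 // ltr_wpDl.
  have n0 : `|t| != 0 by rewrite normr_eq0.
  have : `|D| * `|t| ^ p <= C * `|t| ^ q by near: t.
  have -> : `|t| ^ q = `|t| ^ (q - p) * `|t| ^ p by rewrite -expfzDr // subrK.
  rewrite mulrA ler_pM2r ?exprz_gt0 ?normr_gt0 //.
  apply/negP; rewrite -ltNge.
  rewrite ltr_pdivlMr ?ltr_wpDl // in tD; apply: le_lt_trans tD.
  apply: le_trans (ler_norm _) _; rewrite normrM mulrC.
  apply: ler_pM => //; last by rewrite lerDl.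
  have [k ->] : exists k : nat, q - p = k.+1 by exists (absz (q - p)).-1; lia.
  rewrite -exprnP normrX normr_id -[leRHS]expr1.
  by rewrite ler_wiXn2l.
by case/filter_ex.
Unshelve. all: by end_near. Qed.

End DilationDerivatives.

(** * Order of the pullback in t against the weights of the coefficients *)

Section Pullback.
Set Implicit Arguments.
Unset Strict Implicit.
Variables (R : realType) (n : nat) (wt : 'I_n -> nat).
Implicit Types (X Y : vfield R n) (U : set 'rV[R]_n) (a : {ffun 'I_n -> nat}).
Hypothesis wt_gt0 : forall i, (0 < wt i)%N.

Lemma norm_exprz (t : R) (m : int) : `|t ^ m| = `|t| ^ m.
Proof. by case: m => k; rewrite ?NegzE -?exprnN ?normfV -?exprnP normrX. Qed.

Lemma mderiv_pullback U Y a j (t : R) x : open U -> smooth_vfield U Y ->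
  t != 0 -> `|t| <= 1 -> U (dilation wt t x) ->
  mderiv a (coef (pullback wt t Y) j) x =
  t ^ ((wdeg wt a)%:Z - (wt j)%:Z) * mderiv a (coef Y j) (dilation wt t x).
Proof.
move=> oU sY t0 t1 Ux.
have -> : coef (pullback wt t Y) j =
    (fun y => t^-1 ^+ wt j * coef Y j (dilation wt t y)).
  by apply/funext => y; rewrite coef_pullback.
rewrite !mderivE (pderivs_dilation wt_gt0 _ oU (sY j)) // seq_weight_monoseq.
by rewrite mulrA expfzDr // -exprz_inv [_ ^ _ * _]mulrC.
Qed.

Lemma dilation0 (t : R) : dilation wt t (0 : 'rV[R]_n) = 0.
Proof. by apply/rowP => j; rewrite !mxE mulr0. Qed.

(** Transfers estimates along the pullback identities, which are available for nonzero [t]. *)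
Lemma vfield_bigO_near U (F G : R -> vfield R n) N :
  (forall t, t != 0 -> F t = G t) -> vfield_bigO U F N -> vfield_bigO U G N.
Proof.
move=> FG HF K cK KU a j; have [C HC] := HF K cK KU a j; exists C.
near=> t => x Kx; have t0 : t != 0 by near: t; exact: nbhs_dnbhs_neq.
by rewrite -FG //; move: x Kx; near: t.
Unshelve. all: by end_near. Qed.

Lemma pullback_bigOP U Y (N : int) : open U -> U 0 -> smooth_vfield U Y ->
  vfield_bigO U (fun t => pullback wt t Y) N <->
  forall j, fun_weight_ge wt (N + (wt j)%:Z) (coef Y j).
Proof.
move=> oU U0 sY; split=> [H j a am|H K cK KU a j].
  (* The origin is fixed by all dilations, so there the derivative of the pullback is a pure power
     of [t] times a Taylor derivative. *)
  have [||C HC] := H [set 0] _ _ a j; first exact: compact_set1.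
    by move=> _ ->.
  apply: (@eq0_of_bigO _ _ C ((wdeg wt a)%:Z - (wt j)%:Z) N); first by lia.
  near=> t.
  have t0 : t != 0 by near: t; exact: nbhs_dnbhs_neq.
  have t1 : `|t| <= 1 by near: t; exact: dnbhs0_le.
  have -> : `|mderiv a (coef Y j) 0| * `|t| ^ ((wdeg wt a)%:Z - (wt j)%:Z) =
            `|mderiv a (coef (pullback wt t Y) j) 0|.
    by rewrite (mderiv_pullback _ _ oU sY) ?dilation0 // normrM norm_exprz mulrC.
  suff : forall x, [set (0 : 'rV[R]_n)] x ->
    `|mderiv a (coef (pullback wt t Y) j) x| <= C * `|t| ^ N by apply.
  by near: t.
have /compact_bounded [M [_ MK]] := cK.
pose B := `|M| + 1.
have B0 : 0 <= B by rewrite addr_ge0.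
have KB x : K x -> `|x| <= B.
  by apply: MK; rewrite ltr_pwDr // ler_norm.
(* [m] is [N + wt j - wdeg wt a] cut off at 0: the order to which the derivative [a] of the
   coefficient is known to vanish. *)
have [m [mN Nm]] : exists m : nat,
    (forall k : nat, (k < m)%N -> k%:Z + (wdeg wt a)%:Z < N + (wt j)%:Z) /\
    N <= (wdeg wt a)%:Z - (wt j)%:Z + m%:Z.
  case E : (N + (wt j)%:Z - (wdeg wt a)%:Z) => [p|p].
    by exists p; split=> [k|]; lia.
  by exists 0; split=> [k|]; lia.
have [//||//|C C0 HC] :=
    @weighted_bound _ _ wt wt_gt0 U (mderiv a (coef Y j)) m B oU U0.
- by rewrite mderivE; exact: smooth_on_pderivs.
- move=> s sm; rewrite mderivE -pderivs_cat.
  apply: (fun_weight_geP _ _ oU U0 (sY j)).1 (H j) _ _.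
  rewrite /seq_weight big_cat /= -!/(seq_weight _ _).
  by rewrite seq_weight_monoseq PoszD; exact: mN.
have nU : \forall y \near (0 : 'rV[R]_n), U y by exact: open_nbhs_nbhs.
exists C; near=> t => x /KB xB.
have t0 : t != 0 by near: t; exact: nbhs_dnbhs_neq.
have t1 : `|t| <= 1 by near: t; exact: dnbhs0_le.
have Ut : U (dilation wt t x).
  by move: x xB; near: t; exact: near_dilation.
have hC : `|mderiv a (coef Y j) (dilation wt t x)| <= C * `|t| ^+ m.
  by move: x xB {Ut}; near: t.
rewrite (mderiv_pullback _ _ oU sY) // normrM norm_exprz.
have tp : 0 < `|t| by rewrite normr_gt0.
apply: (@le_trans _ _ (`|t| ^ ((wdeg wt a)%:Z - (wt j)%:Z) * (C * `|t| ^+ m))).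
  by rewrite ler_pM2l ?exprz_gt0.
rewrite mulrCA exprnP -expfzDr ?gt_eqF //; apply: ler_wpM2l => //.
have [k ->] : exists k : nat, (wdeg wt a)%:Z - (wt j)%:Z + m%:Z = N + k%:Z.
  by exists (absz ((wdeg wt a)%:Z - (wt j)%:Z + m%:Z - N)%R); lia.
rewrite expfzDr ?gt_eqF // ler_piMr ?exprz_ge0 //.
  exact: exprn_ile1.
Unshelve. all: by end_near. Qed.

End Pullback.

(** * Polynomial functions: smoothness, Taylor coefficients at 0, weighted homogeneous
    polynomials *)

Section Polynomials.
Import (canonicals, coercions) mpoly.
Set Implicit Arguments.
Unset Strict Implicit.
Variables (R : realType) (n : nat).
Implicit Types (U : set 'rV[R]_n) (p q : mpoly.mpoly n R) (x y : 'rV[R]_n).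
Implicit Types (m : mpoly.multinom n) (a : {ffun 'I_n -> nat}) (s : seq 'I_n).

Definition peval p x : R := mpoly.meval (fun i => x 0 i) p.

Lemma coord_derive x i j :
  is_derive x (delta_mx 0 i) (fun y : 'rV[R]_n => y 0 j) (i == j)%:R.
Proof.
have H : (fun h : R => h^-1 *: ((h *: delta_mx 0 i + x : 'rV[R]_n) 0 j - x 0 j))
    @ 0^' --> ((i == j)%:R : R).
  apply: cvg_near_cst; exists 1 => //= h _ h0.
  by rewrite !mxE /= addrK [_ *: _]mulrA mulVf // mul1r eq_sym.
by apply: DeriveDef; [apply/cvg_ex; exists (i == j)%:R|exact: cvg_lim].
Qed.

(** The agreement of formal and analytic derivatives, packaged with continuity so that it passes
    through sums and products to all polynomials. *)
Definition peval_regular p : Prop := forall x, {for x, continuous (peval p)} /\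
  forall i, is_derive x (delta_mx 0 i) (peval p) (peval (mpoly.mderiv i p) x).

Lemma peval_regularD p q :
  peval_regular p -> peval_regular q -> peval_regular (p + q).
Proof.
have E r1 r2 : peval (r1 + r2) = (fun x => peval r1 x + peval r2 x).
  by apply/funext => x; exact: mpoly.mevalD.
move=> hp hq x; have [cp dp] := hp x; have [cq dq] := hq x; split=> [|i].
  by rewrite E; apply: continuousD.
by rewrite mpoly.mderivD !E; apply: is_deriveD.
Qed.

Lemma peval_regularM p q :
  peval_regular p -> peval_regular q -> peval_regular (p * q).
Proof.
have E r1 r2 : peval (r1 * r2) = (fun x => peval r1 x * peval r2 x).
  by apply/funext => x; exact: mpoly.mevalM.
move=> hp hq x; have [cp dp] := hp x; have [cq dq] := hq x; split=> [|i].
  by rewrite E; apply: continuousM.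
rewrite mpoly.mderivM [peval (_ + _) _]mpoly.mevalD -!/(peval _ _) !E.
apply: is_derive_eq (is_deriveM (dp i) (dq i)) _.
by rewrite addrC; congr (_ + _); rewrite mulrC.
Qed.

Lemma peval_regularC (c : R) : peval_regular (mpoly.mpolyC n c).
Proof.
have E b : peval (mpoly.mpolyC n b) = fun=> b.
  by apply/funext => x; exact: mpoly.mevalC.
move=> x; split=> [|i]; first by rewrite E; exact: cst_continuous.
by rewrite mpoly.mderivC -mpoly.mpolyC0 !E; exact: is_derive_cst.
Qed.

Lemma peval_regular_var j : peval_regular (mpoly.mpolyX R (mpoly.mnm1 j)).
Proof.
have E : peval (mpoly.mpolyX R (mpoly.mnm1 j)) = fun x => x 0 j.
  by apply/funext => x; exact: mpoly.mevalXU.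
move=> x; split=> [|i]; first by rewrite E; exact: coord_continuous.
rewrite E; apply: is_derive_eq (coord_derive x i j) _.
rewrite mpoly.mderivX mpoly.mnm1E /peval mpoly.mevalZ eq_sym.
have [->|] := eqVneq j i; last by rewrite mul0r.
have -> : mpoly.mnm_sub (mpoly.mnm1 i) (mpoly.mnm1 i) = @mpoly.mnm0 n.
  by apply/mpoly.mnmP => k; rewrite mpoly.mnmBE subnn mpoly.mnm0E.
by rewrite mpoly.mpolyX0 mpoly.meval1 mulr1.
Qed.

Lemma peval_regularP p : peval_regular p.
Proof.
have r1 : peval_regular 1 by exact: peval_regularC.
elim/mpoly.mpolyind: p => [|c m p _ _ rp].
  by rewrite -mpoly.mpolyC0; exact: peval_regularC.
apply: peval_regularD => //; rewrite -mpoly.mul_mpolyC.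
apply: peval_regularM; first exact: peval_regularC.
rewrite mpoly.mpolyXE_id; elim/big_ind: _ => // [q1 q2|i _].
  exact: peval_regularM.
elim: (m i) => [|k IH]; first by rewrite expr0.
by rewrite exprS; apply: peval_regularM => //; exact: peval_regular_var.
Qed.

Lemma smooth_peval U p : open U -> smooth_on U (peval p) /\
  forall s x, U x ->
    pderivs s (peval p) x = peval (foldr (@mpoly.mderiv n R) p s) x.
Proof.
move=> oU.
apply: (@smooth_on_family _ _ U
  (fun s => peval (foldr (@mpoly.mderiv n R) p s))) => //.
- by move=> s x _; exact: (peval_regularP _ x).1.
- by move=> s i x _; exact: (peval_regularP _ x).2.
Qed.

Lemma peval_at0 p : peval p 0 = mpoly.mcoeff (@mpoly.mnm0 n) p.
Proof.
elim/mpoly.mpolyind: p => [|c m p _ _ IH].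
  by rewrite /peval mpoly.meval0 mpoly.mcoeff0.
rewrite /peval mpoly.mevalD mpoly.mcoeffD mpoly.mevalZ mpoly.mcoeffZ.
rewrite mpoly.mcoeffX mpoly.mevalX -/(peval p 0) IH; congr (_ * _ + _).
have [->|m0] := eqVneq m (@mpoly.mnm0 n).
  by rewrite big1 // => i _; rewrite mpoly.mnm0E expr0.
have [i mi] : exists i, m i != 0%N.
  apply/existsP; apply: contraNT m0 => /existsPn H; apply/eqP/mpoly.mnmP => i.
  by rewrite mpoly.mnm0E; apply/eqP; have := H i; rewrite negbK.
by rewrite (bigD1 i) //= mxE expr0n (negbTE mi) mul0r.
Qed.

Definition mnm_of a : mpoly.multinom n := mpoly.Multinom [tuple a i | i < n].

(** Each formal derivative shifts the coefficients and multiplies by a positive integer. The factor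
    [c] is uniform in [p], so it can be divided out. *)
Lemma mcoeff_mderivs s k : exists2 c : nat, (0 < c)%N & forall p,
  mpoly.mcoeff k (foldr (@mpoly.mderiv n R) p s) =
  mpoly.mcoeff (mnm_of [ffun i => k i + count_mem i s]%N) p *+ c.
Proof.
elim: s k => [|i s IH] k.
  exists 1%N => // p /=; rewrite mulr1n; congr (mpoly.mcoeff _ _).
  by apply/mpoly.mnmP => j; rewrite mpoly.mnmE ffunE addn0.
have [c c0 H] := IH (mpoly.mnm_add k (mpoly.mnm1 i)).
exists (c * (k i).+1)%N; first by rewrite muln_gt0 c0.
move=> p; rewrite [foldr _ _ _]/= mpoly.mcoeff_mderiv H -mulrnA.
congr (mpoly.mcoeff _ _ *+ _); apply/mpoly.mnmP => j.
by rewrite !mpoly.mnmE !ffunE mpoly.mnmDE mpoly.mnm1E /= addnA.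
Qed.

Lemma pderivs_peval_at0 a : exists2 c : R, c != 0 & forall p,
  mderiv a (peval p) 0 = mpoly.mcoeff (mnm_of a) p * c.
Proof.
have [c c0 H] := mcoeff_mderivs (monoseq a) (@mpoly.mnm0 n).
exists c%:R => [|p]; first by rewrite pnatr_eq0 -lt0n.
rewrite mderivE (smooth_peval p openT).2 // peval_at0 H mulr_natr.
congr (mpoly.mcoeff _ _ *+ _); apply/mpoly.mnmP => j.
by rewrite !mpoly.mnmE ffunE mpoly.mnm0E count_monoseq.
Qed.

Variable wt : 'I_n -> nat.
Hypothesis wt_gt0 : forall i, (0 < wt i)%N.

(** The witness is the Taylor polynomial with prescribed derivatives [T a]: the sum of [T a / c a]
    times the monomial of [a], over [a] of weighted degree [k]. *)
Lemma whomog_peval_ex (T : {ffun 'I_n -> nat} -> R) (k : nat) : exists p,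
  (forall t x, peval p (dilation wt t x) = t ^+ k * peval p x) /\
  forall a, mderiv a (peval p) 0 = if wdeg wt a == k then T a else 0.
Proof.
(* [c a] is the multi-index factorial of [a], known here only through its defining property. *)
pose c a := sval (cid2 (pderivs_peval_at0 a)).
have c0 a : c a != 0 by rewrite /c; case: cid2.
have cE a p : mderiv a (peval p) 0 = mpoly.mcoeff (mnm_of a) p * c a.
  by rewrite /c; case: cid2.
pose ff m : {ffun 'I_n -> nat} := [ffun i => m i].
have ffK a : ff (mnm_of a) = a by apply/ffunP => i; rewrite ffunE mpoly.mnmE.
have mono m t x : \prod_i (dilation wt t x) 0 i ^+ m i =
    t ^+ wdeg wt (ff m) * \prod_i x 0 i ^+ m i.
  rewrite /wdeg -prodrXr -big_split /=; apply: eq_bigr => i _.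
  by rewrite mxE exprMn ffunE exprM.
exists (\sum_(m : mpoly.bmultinom n k.+1 | wdeg wt (ff m) == k)
   (T (ff m) / c (ff m)) *: mpoly.mpolyX R m).
split=> [t x|a].
  rewrite /peval !raddf_sum mulr_sumr; apply: eq_bigr => m /eqP mk.
  by rewrite /= !mpoly.mevalZ !mpoly.mevalX mono mk mulrCA.
rewrite cE raddf_sum /=.
under eq_bigr do rewrite mpoly.mcoeffZ mpoly.mcoeffX.
have [ak|ak] := eqVneq (wdeg wt a) k; last first.
  rewrite big1 ?mul0r // => m mk.
  have [E|] := eqVneq (m : mpoly.multinom n) (mnm_of a); last by rewrite mulr0.
  by rewrite E ffK (negbTE ak) in mk.
(* Positive weights bound the degree by the weighted degree, so the finite range of the sum misses
   no multi-index of weighted degree [k]. *)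
have dega : (mpoly.mdeg (mnm_of a) < k.+1)%N.
  rewrite ltnS -ak mpoly.mdegE; apply: leq_sum => i _.
  by rewrite mpoly.mnmE leq_pmull.
rewrite (bigD1 (mpoly.BMultinom dega)) /=; last by rewrite ffK ak.
rewrite eqxx mulr1 ffK big1 ?addr0 ?mulfVK // => m /andP[_ ma].
have [E|] := eqVneq (m : mpoly.multinom n) (mnm_of a); last by rewrite mulr0.
by case/eqP: ma; exact: val_inj.
Qed.

End Polynomials.

(** * Taylor coefficients of homogeneous fields and of partial expansions *)

Section Expansion.
Set Implicit Arguments.
Unset Strict Implicit.
Variables (R : realType) (n : nat) (wt : 'I_n -> nat).
Implicit Types (X Y : vfield R n) (U : set 'rV[R]_n) (a : {ffun 'I_n -> nat}).
Hypothesis wt_gt0 : forall i, (0 < wt i)%N.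

(* The degree of homogeneity of x^a d/dx_j. *)
Definition field_deg a j : int := (wdeg wt a)%:Z - (wt j)%:Z.

Lemma pullbackB (t : R) X Y x : t != 0 ->
  pullback wt t X x - pullback wt t Y x = pullback wt t (fun y => X y - Y y) x.
Proof.
move=> t0; apply/rowP => j.
have c Z : pullback wt t Z x 0 j = t^-1 ^+ wt j * Z (dilation wt t x) 0 j.
  exact: coef_pullback.
by rewrite [LHS]mxE [X in _ + X]mxE !c -mulrBr !mxE.
Qed.

Lemma pullback_sum (t : R) (I : Type) (s : seq I) (Y : I -> vfield R n) x :
  t != 0 -> \sum_(k <- s) pullback wt t (Y k) x =
            pullback wt t (fun y => \sum_(k <- s) Y k y) x.
Proof.
move=> t0; apply/rowP => j; rewrite summxE.
have c Z : pullback wt t Z x 0 j = t^-1 ^+ wt j * Z (dilation wt t x) 0 j.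
  exact: coef_pullback.
under eq_bigr do rewrite c.
by rewrite c summxE mulr_sumr.
Qed.

Lemma smooth_polynomial_vfield U Y :
  open U -> polynomial_vfield Y -> smooth_vfield U Y.
Proof.
move=> oU pY j; have [p pE] := pY j.
have -> : coef Y j = peval p by apply/funext.
exact: (smooth_peval p oU).1.
Qed.

Lemma smooth_vfieldB U X Y : open U -> smooth_vfield U X -> smooth_vfield U Y ->
  smooth_vfield U (fun x => X x - Y x) /\ forall a j x, U x ->
    mderiv a (coef (fun x => X x - Y x) j) x =
    mderiv a (coef X j) x - mderiv a (coef Y j) x.
Proof.
move=> oU sX sY.
have E j : coef (fun x => X x - Y x) j = fun x => coef X j x + (-1) * coef Y j x.
  by apply/funext => x; rewrite /coef !mxE mulN1r.
split=> [j|a j x Ux]; rewrite E.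
  exact: (smooth_on_addZ _ oU (sX j) (sY j)).1.
by rewrite !mderivE (smooth_on_addZ _ oU (sX j) (sY j)).2 // mulN1r.
Qed.

Lemma smooth_vfield_sum U (I : Type) (s : seq I) (Y : I -> vfield R n) :
  open U -> (forall k, smooth_vfield U (Y k)) ->
  smooth_vfield U (fun x => \sum_(k <- s) Y k x) /\ forall a j x, U x ->
  mderiv a (coef (fun x => \sum_(k <- s) Y k x) j) x
  = \sum_(k <- s) mderiv a (coef (Y k) j) x.
Proof.
move=> oU sY.
have E j : coef (fun x => \sum_(k <- s) Y k x) j =
    fun x => \sum_(k <- s) coef (Y k) j x.
  by apply/funext => x; rewrite /coef summxE.
split=> [j|a j x Ux]; rewrite E.
  by apply: (smooth_on_sum s oU _).1 => k; exact: sY.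
by rewrite mderivE (smooth_on_sum s oU _).2 // => k; exact: sY.
Qed.

(** Differentiating the homogeneity relation at 0 multiplies the derivative by [t ^ field_deg a j]
    on one side and by [t ^ l] on the other. At [t = 1/2] these powers differ, so the derivative is
    0. *)
Lemma mderiv_homogeneous U Y (l : int) a j : open U -> U 0 ->
  smooth_vfield U Y -> homogeneous wt l Y -> field_deg a j != l ->
  mderiv a (coef Y j) 0 = 0.
Proof.
move=> oU U0 sY hY al; pose t : R := 2^-1.
have t0 : t != 0 by rewrite invr_eq0 pnatr_eq0.
have t1 : `|t| <= 1 by rewrite ger0_norm ?invr_ge0 // invf_le1 // ler1n.
have := @mderiv_pullback _ _ _ wt_gt0 U Y a j t 0 oU sY t0 t1.
rewrite dilation0 => /(_ U0).
have -> : coef (pullback wt t Y) j = fun x => 0 + t ^ l * coef Y j x.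
  by apply/funext => x; rewrite /coef (hY t t0) mxE add0r.
have [s0 d0] := smooth_on_cst0 oU.
rewrite mderivE (smooth_on_addZ _ oU s0 (sY j)).2 // d0 // add0r => /eqP.
rewrite -subr_eq0 -mulrBl mulf_eq0 subr_eq0 => /orP[|/eqP //].
have tp : 0 < t by rewrite invr_gt0.
have tn : t != 1 by rewrite invr_eq1 (eqr_nat R 2 1).
by move=> /eqP /(ieexprIz tp tn) E; rewrite /field_deg -E eqxx in al.
Qed.

Lemma monoseq0 : monoseq ([ffun=> 0%N] : {ffun 'I_n -> nat}) = [::].
Proof.
rewrite /monoseq; elim: (enum _) => //= i s ->.
by rewrite ffunE.
Qed.

(** Vanishing Taylor coefficients make the pullback, which is [t ^ l *: Y], of order [l + 1]; this
    forces [Y] to vanish on [U]. *)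
Lemma homogeneous_eq0 U Y (l : int) : open U -> U 0 ->
  smooth_vfield U Y -> homogeneous wt l Y ->
  (forall a j, mderiv a (coef Y j) 0 = 0) -> Y = cst 0.
Proof.
move=> oU U0 sY hY Y0.
have O : vfield_bigO U (fun t x => t ^ l *: Y x) (l + 1).
  apply: (@vfield_bigO_near _ _ _ (fun t => pullback wt t Y)).
    by move=> t t0; apply/funext => x; exact: hY.
  by apply/(pullback_bigOP wt_gt0 _ oU U0 sY) => j a _; exact: Y0.
have YU x j : U x -> Y x 0 j = 0.
  move=> Ux; have [||C HC] := O [set x] _ _ [ffun=> 0%N] j.
  - exact: compact_set1.
  - by move=> _ ->.
  apply: (@eq0_of_bigO _ _ C l (l + 1)); first by lia.
  apply: filterS HC => t /(_ x erefl).
  by rewrite mderivE monoseq0 /= /coef mxE normrM norm_exprz mulrC.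
apply/funext => x; apply/rowP => j; rewrite mxE.
have nU : \forall y \near (0 : 'rV[R]_n), U y by exact: open_nbhs_nbhs.
(* A small dilation brings any [x] into [U], and homogeneity carries the vanishing back to [x]. *)
have [t [t0 tU]] : exists t : R, t != 0 /\ U (dilation wt t x).
  apply: (@filter_ex _ (0 : R)^'); near=> t; split.
    by near: t; exact: nbhs_dnbhs_neq.
  suff : forall y, `|y| <= `|x| -> U (dilation wt t y) by apply.
  by near: t; exact: near_dilation.
have := coef_pullback wt Y j x t0; rewrite /coef (hY t t0) mxE YU // mulr0.
by move/eqP; rewrite mulf_eq0 (negbTE (expfz_neq0 _ t0)) => /eqP.
Unshelve. all: by end_near. Qed.

Variable r : nat.
Hypothesis wt_le : forall i, (wt i <= r)%N.

Lemma field_deg_ge a j : - r%:Z <= field_deg a j.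
Proof. by rewrite /field_deg; have := wt_le j; lia. Qed.

(** By homogeneity the partial expansion is the pullback of the plain sum [P] of its terms, so
    [pullback_bigOP] applies to [X - P]. *)
Lemma expansion_bigOP U X (Xh : int -> vfield R n) (N : int) :
  open U -> U 0 -> smooth_vfield U X ->
  (forall l, - r%:Z <= l ->
    polynomial_vfield (Xh l) /\ homogeneous wt l (Xh l)) ->
  vfield_bigO U
    (fun t x => pullback wt t X x - partial_expansion r Xh N t x) N <->
  forall a j, field_deg a j < N ->
    mderiv a (coef X j) 0 = mderiv a (coef (Xh (field_deg a j)) j) 0.
Proof.
move=> oU U0 sX hX.
set K := absz (Num.max 0 (N + r%:Z)).
have lr k : - r%:Z <= k%:Z - r%:Z :> int by lia.
have sXh k : smooth_vfield U (Xh (k%:Z - r%:Z)).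
  by apply: smooth_polynomial_vfield => //; exact: (hX _ (lr k)).1.
pose P : vfield R n := fun x => \sum_(0 <= k < K) Xh (k%:Z - r%:Z) x.
have [sP dP] : smooth_vfield U P /\ forall a j x, U x ->
    mderiv a (coef P j) x =
    \sum_(0 <= k < K) mderiv a (coef (Xh (k%:Z - r%:Z)) j) x.
  exact: smooth_vfield_sum.
have [sD dD] := smooth_vfieldB oU sX sP.
have FE t : t != 0 ->
    (fun x => pullback wt t X x - partial_expansion r Xh N t x) =
    pullback wt t (fun x => X x - P x).
  move=> t0; apply/funext => x; rewrite -pullbackB //; congr (_ - _).
  rewrite /P -pullback_sum // /partial_expansion; apply: eq_bigr => k _.
  by rewrite (hX _ (lr k)).2.
have DP a j : field_deg a j < N ->
    mderiv a (coef P j) 0 = mderiv a (coef (Xh (field_deg a j)) j) 0.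
  move=> aN; have ar := field_deg_ge a j; rewrite dP //.
  (* Only the term of degree [field_deg a j] contributes; its index is nonnegative by
     [field_deg_ge]. *)
  have E k : mderiv a (coef (Xh (k%:Z - r%:Z)) j) 0 =
      if k == absz (field_deg a j + r%:Z)%R
      then mderiv a (coef (Xh (field_deg a j)) j) 0 else 0.
    case: eqP => [->|ne].
      by congr (mderiv a (coef (Xh _) j) 0); lia.
    apply: mderiv_homogeneous oU U0 (sXh k) (hX _ (lr k)).2 _.
    by apply/eqP; lia.
  under eq_bigr do rewrite E.
  rewrite -big_mkcond big_nat1_eq /=.
  suff -> : (absz (field_deg a j + r%:Z)%R < K)%N by [].
  by rewrite /K; lia.
have key := pullback_bigOP wt_gt0 N oU U0 sD.
split=> [H a j aN|H].
  have /key /(_ j a) :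
      vfield_bigO U (fun t => pullback wt t (fun x => X x - P x)) N.
    by apply: vfield_bigO_near H.
  rewrite dD // DP // => /(_ _)/eqP; rewrite subr_eq0 => E; apply/eqP/E.
  by move: aN; rewrite /field_deg; lia.
apply: (@vfield_bigO_near _ _ _ (fun t => pullback wt t (fun x => X x - P x))).
  by move=> t t0; rewrite FE.
apply/key => j a am.
have aN : field_deg a j < N by rewrite /field_deg; lia.
by rewrite dD // DP // H // subrr.
Qed.

End Expansion.

(** * Existence of the expansion and characterization of the weight *)

Lemma homogeneous_expansion_ex (R : realType) (n r : nat) (wt : 'I_n -> nat)
    (wt_bounds : forall i, (1 <= wt i <= r)%N)
    (U : set 'rV[R]_n) (U_open : open U) (U_0 : U 0)
    (X : vfield R n) (X_smooth : smooth_vfield U X) :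
  exists Xh : int -> vfield R n, homogeneous_expansion wt r U X Xh.
Proof.
have wt_gt0 i : (0 < wt i)%N by have /andP[] := wt_bounds i.
have wt_le i : (wt i <= r)%N by have /andP[] := wt_bounds i.
(* The coefficient [j] of the field of degree [l] is the part of weighted degree [l + wt j] of the
   Taylor series of [coef X j]. *)
have step (lj : int * 'I_n) : exists p : mpoly.mpoly n R,
    [/\ forall t x, t != 0 ->
          peval p (dilation wt t x) = t ^ (lj.1 + (wt lj.2)%:Z) * peval p x,
        forall a, field_deg wt a lj.2 = lj.1 ->
          mderiv a (peval p) 0 = mderiv a (coef X lj.2) 0
      & lj.1 + (wt lj.2)%:Z < 0 -> forall x, peval p x = 0].
  case: lj => l j /=; case E : (l + (wt j)%:Z) => [k|k].
    have [p [hp dp]] :=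
      whomog_peval_ex wt_gt0 (fun a => mderiv a (coef X j) 0) k.
    exists p; split=> // a al.
    by rewrite dp ifT //; apply/eqP; move: al; rewrite /field_deg; lia.
  (* For negative [l + wt j] there is no such multi-index, and the zero polynomial is taken. *)
  have p0 x : peval (mpoly.mpolyC n (0 : R)) x = 0 by exact: mpoly.mevalC.
  exists (mpoly.mpolyC n 0); split=> [t x _|a al|_ x]; rewrite ?p0 ?mulr0 //.
  by exfalso; move: al; rewrite /field_deg; lia.
have [p hp] := choice step.
pose Xh l : vfield R n := fun x => \row_j peval (p (l, j)) x.
have cXh l j : coef (Xh l) j = peval (p (l, j)).
  by apply/funext => x; rewrite /coef mxE.
have hXh l : polynomial_vfield (Xh l) /\ homogeneous wt l (Xh l).
  split=> [j|t t0 x]; first by exists (p (l, j)) => x; rewrite cXh.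
  apply/rowP => j; rewrite -/(coef _ _ _) coef_pullback // !mxE cXh.
  have [-> // _ _] := hp (l, j).
  by rewrite /= expfzDr // exprVn mulrA mulrCA mulVf ?mulr1 ?expf_neq0.
exists Xh; split=> // [l lr|N].
  apply/funext => x; apply/rowP => j; rewrite !mxE.
  have [_ _ ->] // := hp (l, j).
  by have /= := wt_le j; lia.
apply/(expansion_bigOP wt_gt0 wt_le _ U_open U_0 X_smooth) => // a j _.
by rewrite cXh; have [_ /(_ a erefl) -> _] := hp (field_deg wt a j, j).
Qed.

Theorem proposition4p32 (R : realType) (n r : nat) (wt : 'I_n -> nat)
    (wt_bounds : forall i, (1 <= wt i <= r)%N)
    (wt_nondecreasing : forall i j : 'I_n, (i <= j)%N -> (wt i <= wt j)%N)
    (U : set 'rV[R]_n) (U_open : open U) (U_0 : U 0)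
    (X : vfield R n) (X_smooth : smooth_vfield U X) :
  (exists Xh : int -> vfield R n, homogeneous_expansion wt r U X Xh) /\
  (forall Xh : int -> vfield R n, homogeneous_expansion wt r U X Xh ->
    forall w : int,
      vfield_weight wt w X <->
      (Xh w <> cst 0 /\
       vfield_bigO U (fun t x => pullback wt t X x - t ^ w *: Xh w x) (w + 1))).
Proof.
split; first exact: homogeneous_expansion_ex.
have wt_gt0 i : (0 < wt i)%N by have /andP[] := wt_bounds i.
have wt_le i : (wt i <= r)%N by have /andP[] := wt_bounds i.
move=> Xh [hXh Xh0 expXh] w.
(* The order [field_deg wt a j + 1] is the first whose partial expansion includes the term of degree
   [field_deg wt a j]. *)
have DX a j :
    mderiv a (coef X j) 0 = mderiv a (coef (Xh (field_deg wt a j)) j) 0.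
  have H := (expansion_bigOP wt_gt0 wt_le _ U_open U_0 X_smooth hXh).1
    (expXh (field_deg wt a j + 1)).
  by apply: H; lia.
(* Below [-r] both sides fail: [Xh w] is 0 by convention, and weight [w] would need a multi-index of
   negative weighted degree. *)
have [wr|wr] := ltP w (- r%:Z).
  rewrite (Xh0 _ wr); split=> [[_ [j [_ [a [aw _]]]]]|[]//].
  by exfalso; have := wt_le j; lia.
have [pXh homXh] := hXh w wr.
have sXh := smooth_polynomial_vfield U_open pXh.
have DXh a j : field_deg wt a j != w -> mderiv a (coef (Xh w) j) 0 = 0.
  exact: (mderiv_homogeneous wt_gt0 U_open U_0 sXh homXh).
have [sD dD] := smooth_vfieldB U_open X_smooth sXh.
have FE t : t != 0 -> (fun x => pullback wt t X x - t ^ w *: Xh w x) =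
    pullback wt t (fun x => X x - Xh w x).
  by move=> t0; apply/funext => x; rewrite -pullbackB // homXh.
have key := pullback_bigOP wt_gt0 (w + 1) U_open U_0 sD.
split.
- case=> Xw [j [_ [a [aw Xa]]]]; split.
    move=> Xhw0; apply: Xa; rewrite DX.
    have -> : field_deg wt a j = w by rewrite /field_deg; lia.
    have -> : coef (Xh w) j = fun=> 0.
      by apply/funext => x; rewrite /coef Xhw0 mxE.
    by rewrite mderivE (smooth_on_cst0 U_open).2.
  apply: (@vfield_bigO_near _ _ _
    (fun t => pullback wt t (fun x => X x - Xh w x))).
    by move=> t t0; rewrite FE.
  (* Taylor coefficients of degree [w] cancel in [X - Xh w]; those of lower degree vanish for both
     fields. *)
  apply/key => i b bw; rewrite dD //.
  have [E|ne] := eqVneq (field_deg wt b i) w; first by rewrite DX E subrr.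
  by rewrite (DXh _ _ ne) subr0; apply: Xw; move/eqP: ne; rewrite /field_deg; lia.
- case=> Xhw0 O.
  have /key Dw :
      vfield_bigO U (fun t => pullback wt t (fun x => X x - Xh w x)) (w + 1).
    exact: vfield_bigO_near O.
  have ge j : fun_weight_ge wt (w + (wt j)%:Z) (coef X j).
    move=> a aw.
    have ne : field_deg wt a j != w by apply/eqP; rewrite /field_deg; lia.
    have := Dw j a; rewrite dD // (DXh _ _ ne) subr0; apply; lia.
  (* A nonzero homogeneous field has a nonzero Taylor coefficient; it sits in degree [w] by [DXh]
     and is shared with [X] by [DX]. *)
  split=> //; have [j [a Da]] : exists j a, mderiv a (coef (Xh w) j) 0 <> 0.
    apply: contrapT => H; apply: Xhw0.
    apply: (homogeneous_eq0 wt_gt0 U_open U_0 sXh homXh) => a j.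
    by apply: contrapT => Da; apply: H; exists j, a.
  have aw : field_deg wt a j = w by apply/eqP; apply: contra_notT Da; exact: DXh.
  exists j; split=> //; exists a; split.
    by move: aw; rewrite /field_deg; lia.
  by rewrite DX aw.
Qed.
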